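(* Let $a,b\in\mathbb{C}$ with $(a,b)\neq(1,0)$, and $\alpha,\bar\alpha,\beta,\bar\beta\in\mathbb{C}$ with $\alpha,\bar\alpha\neq0$ and $\beta\neq\bar\beta$. Consider extensions $0\to M_{\bar\alpha,\bar\beta}\to E\to M_{\alpha,\beta}\to0$ of $\mathcal{W}(a,b)$-modules, written as $E=\mathbb{C}[\partial]v_{\bar\alpha}\oplus\mathbb{C}[\partial]v_\alpha$ with $L_\lambda v_\alpha=(\partial+\alpha\lambda+\beta)v_\alpha+f(\partial,\lambda)v_{\bar\alpha}$, $W_\lambda v_\alpha=g(\partial,\lambda)v_{\bar\alpha}$. (0) If $\beta-\bar\beta+b\neq0$, every such extension is trivial. Now assume $\beta-\bar\beta+b=0$. Then every such extension is equivalent to one with $f=0$, and an extension with $f=0$ is nontrivial iff $g\neq0$. Moreover, letting $m$ denote the total degree of $g$, the nonzero $g$ that occur (with $f=0$) are exactly the nonzero scalar multiples of the following polynomials, under the stated conditions: (2) If $a\neq1$: (a) $m=0$: $\alpha-\bar\alpha=1-a$, $g=1$; (b) $m=1$: $\alpha-\bar\alpha=2-a$, $g=\partial-\frac{\bar\alpha}{1-a}\lambda+\frac{\bar\alpha b}{1-a}+\bar\beta$; (c) $m=2$: $\alpha=1$, $\bar\alpha=a-2$, $g=\partial^2-\frac{1+2\bar\alpha}{1-a}\partial\lambda-\frac{\bar\alpha}{1-a}\lambda^2+a_{10}\partial+a_{11}\lambda+a_{00}$ with $a_{10}=2\bar\beta+\frac{(1+2\bar\alpha)b}{1-a}$, $a_{11}=\frac{2b\bar\alpha}{1-a}-\frac{(1+2\bar\alpha)\bar\beta}{1-a}$,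 $a_{00}=\bar\beta^2+\frac{b\bar\beta(1+2\bar\alpha)}{1-a}-\frac{b^2\bar\alpha}{1-a}$; (d) $m=3$: $\alpha=a=\frac53$, $\bar\alpha=-\frac23$, $g=\partial^3+\frac32\partial^2\lambda-\frac32\partial\lambda^2-\lambda^3+a_{20}\partial^2+a_{21}\partial\lambda+a_{22}\lambda^2+a_{10}\partial+a_{11}\lambda+a_{00}$ with $a_{20}=3\bar\beta-\frac32b$, $a_{21}=3\bar\beta+3b$, $a_{22}=-\frac32\bar\beta+3b$, $a_{10}=3\bar\beta^2-3b\bar\beta-\frac32b^2$, $a_{11}=\frac32\bar\beta^2+3b\bar\beta-3b^2$, $a_{00}=\bar\beta^3-\frac32b\bar\beta^2-\frac32b^2\bar\beta+b^3$; and no other degrees occur. (3) If $a=1$: (a) $m=0$: $\alpha=\bar\alpha$, $g=1$; (b) $m=1$: $\alpha-\bar\alpha=1$, $g=\lambda-b$; (c) $m=2$: $\alpha-\bar\alpha=2$, $g=\partial\lambda-\bar\alpha\lambda^2-b\partial+(\bar\beta+2b\bar\alpha)\lambda-(b\bar\beta+b^2\bar\alpha)$; (d) $m=3$: $\alpha=1$, $\bar\alpha=-2$, $g=\partial^2\lambda+3\partial\lambda^2+2\lambda^3-b\partial^2+(2\bar\beta-6b)\partial\lambda+(3\bar\beta-6b)\lambda^2+(3b^2-2b\bar\beta)\partial+(\bar\beta^2-6b\bar\beta+6b^2)\lambda-\bar\beta^2b+3b^2\bar\beta-2b^3$; and no other degrees occur.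
   Context: A conformal module over a Lie conformal algebra $\mathcal{R}$ is a $\mathbb{C}[\partial]$-module $V$ with $\mathbb{C}$-linear maps $\mathcal{R}\otimes V\to V[\lambda]$, $a\otimes v\mapsto a_\lambda v$, such that $(\partial a)_\lambda v=-\lambda a_\lambda v$, $a_\lambda(\partial v)=(\partial+\lambda)a_\lambda v$, and $a_\lambda(b_\mu v)-b_\mu(a_\lambda v)=[a_\lambda b]_{\lambda+\mu}v$. The Lie conformal algebra $\mathcal{W}(a,b)$ is the free $\mathbb{C}[\partial]$-module on $L,W$ with $[L_\lambda L]=(\partial+2\lambda)L$, $[L_\lambda W]=(\partial+a\lambda+b)W$, $[W_\lambda W]=0$. For $(a,b)\neq(1,0)$ and $\alpha\neq0$, $M_{\alpha,\beta}=\mathbb{C}[\partial]v$ with $L_\lambda v=(\partial+\alpha\lambda+\beta)v$, $W_\lambda v=0$. Every extension of $M_{\alpha,\beta}$ by $M_{\bar\alpha,\bar\beta}$ can be written in the displayed form with $f,g\in\mathbb{C}[\partial,\lambda]$, where $\mathbb{C}[\partial]v_{\bar\alpha}\cong M_{\bar\alpha,\bar\beta}$ is a submodule. Equivalence of extensions means a module homomorphism between middle terms compatible with the identities on the end terms; trivial means equivalent to the direct sum extension. *)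

(* Defs.v *)
From HB Require Import structures.
From mathcomp Require Import all_boot all_order all_algebra.
Set Implicit Arguments. Unset Strict Implicit. Unset Printing Implicit Defensive.
Import Order.TTheory GRing.Theory Num.Theory.
Local Open Scope ring_scope.

(* Underlying C[d]-module of the middle term E = C[d] v_abar (+) C[d] v_alpha:
   an element (p, q) stands for p(d) v_abar + q(d) v_alpha.
   The polynomial variable of {poly R} is d (= \partial). *)
Definition Emod (R : numClosedFieldType) := ({poly R} * {poly R})%type.

(* Two-variable polynomials h(d, lambda): outer variable = lambda,
   coefficients are polynomials in d. *)
Notation dd := (('X : {poly _})%:P) (only parsing).
Notation ll := ('X : {poly {poly _}}) (only parsing).
Notation "c %:PP" := ((c%:P)%:P) (at level 2, format "c %:PP").

Definition shp (R : numClosedFieldType) (c : R) (p : {poly R}) : {poly R} :=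
  p \Po ('X + c%:P).
Definition ev2 (R : numClosedFieldType) (h : {poly {poly R}}) (c : R) : {poly R} :=
  h.[c%:P].

(* The lambda-actions of L and W on E, extended from the generators by
   L_lam (p(d) v) = p(d+lam) L_lam v (conformal sesquilinearity):
   L_lam v_abar = (d + abar lam + bbar) v_abar,
   L_lam v_alpha = (d + alpha lam + beta) v_alpha + f(d,lam) v_abar,
   W_lam v_abar = 0,  W_lam v_alpha = g(d,lam) v_abar. *)
Definition actL (R : numClosedFieldType) (al be abar bbar : R)
  (f : {poly {poly R}}) (l : R) (v : Emod R) : Emod R :=
  (shp l v.1 * ('X + (abar * l + bbar)%:P) + shp l v.2 * ev2 f l,
   shp l v.2 * ('X + (al * l + be)%:P)).

Definition actW (R : numClosedFieldType) (g : {poly {poly R}}) (l : R)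
  (v : Emod R) : Emod R :=
  (shp l v.2 * ev2 g l, 0).

Definition scE (R : numClosedFieldType) (c : R) (v : Emod R) : Emod R :=
  (c%:P * v.1, c%:P * v.2).
Definition addE (R : numClosedFieldType) (v w : Emod R) : Emod R :=
  (v.1 + w.1, v.2 + w.2).
Definition subE (R : numClosedFieldType) (v w : Emod R) : Emod R :=
  (v.1 - w.1, v.2 - w.2).
Definition dE (R : numClosedFieldType) (v : Emod R) : Emod R :=
  ('X * v.1, 'X * v.2).

(* The displayed data (f,g) define a conformal W(a,b)-module structure on E:
   the axiom a_lam (b_mu v) - b_mu (a_lam v) = [a_lam b]_{lam+mu} v for the
   generators a, b in {L, W}, using [L_lam L] = (d+2lam)L,
   [L_lam W] = (d + a lam + b) W, [W_lam L] = -[L_{-lam-d} W], [W_lam W] = 0,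
   and (d x)_nu v = -nu x_nu v. Polynomial identities in lam, mu are stated
   pointwise for all lam, mu in R (R is infinite). *)
Definition is_ext (R : numClosedFieldType) (a b al be abar bbar : R)
  (f g : {poly {poly R}}) : Prop :=
  forall (l m : R) (v : Emod R),
    [/\ subE (actL al be abar bbar f l (actL al be abar bbar f m v))
             (actL al be abar bbar f m (actL al be abar bbar f l v))
        = scE (l - m) (actL al be abar bbar f (l + m) v),
        subE (actL al be abar bbar f l (actW g m v))
             (actW g m (actL al be abar bbar f l v))
        = scE (- (l + m) + a * l + b) (actW g (l + m) v),
        subE (actW g l (actL al be abar bbar f m v))
             (actL al be abar bbar f m (actW g l v))
        = scE (l + m - a * m - b) (actW g (l + m) v)
      & subE (actW g l (actW g m v)) (actW g m (actW g l v)) = (0, 0)].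

Definition is_hom (R : numClosedFieldType) (al be abar bbar : R)
  (f g f' g' : {poly {poly R}}) (phi : Emod R -> Emod R) : Prop :=
  [/\ forall v w, phi (addE v w) = addE (phi v) (phi w),
      forall (c : R) v, phi (scE c v) = scE c (phi v),
      forall v, phi (dE v) = dE (phi v),
      forall l v, phi (actL al be abar bbar f l v) = actL al be abar bbar f' l (phi v)
    & forall l v, phi (actW g l v) = actW g' l (phi v)].

(* Equivalence of extensions: a homomorphism of middle terms which is the
   identity on the submodule C[d] v_abar = M_{abar,bbar} and induces the
   identity on the quotient M_{alpha,beta}. *)
Definition ext_equiv (R : numClosedFieldType) (al be abar bbar : R)
  (f g f' g' : {poly {poly R}}) : Prop :=
  exists phi : Emod R -> Emod R,
    [/\ is_hom al be abar bbar f g f' g' phi,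
        forall p, phi (p, 0) = (p, 0)
      & forall v, (phi v).2 = v.2].

Definition ext_trivial (R : numClosedFieldType) (al be abar bbar : R)
  (f g : {poly {poly R}}) : Prop :=
  ext_equiv al be abar bbar f g 0 0.

Section Polys.
Variables (R : numClosedFieldType) (a b abar bbar : R).
Local Notation k := (1 - a)^-1.

Definition g2b : {poly {poly R}} :=
  dd - (abar * k)%:PP * ll + (abar * b * k + bbar)%:PP.

Definition g2c : {poly {poly R}} :=
  dd ^+ 2 - ((1 + 2 * abar) * k)%:PP * dd * ll - (abar * k)%:PP * ll ^+ 2
  + (2 * bbar + (1 + 2 * abar) * b * k)%:PP * dd
  + (2 * b * abar * k - (1 + 2 * abar) * bbar * k)%:PP * ll
  + (bbar ^+ 2 + b * bbar * (1 + 2 * abar) * k - b ^+ 2 * abar * k)%:PP.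

Definition g2d : {poly {poly R}} :=
  dd ^+ 3 + (3%:R / 2%:R)%:PP * dd ^+ 2 * ll - (3%:R / 2%:R)%:PP * dd * ll ^+ 2
  - ll ^+ 3
  + (3%:R * bbar - 3%:R / 2%:R * b)%:PP * dd ^+ 2
  + (3%:R * bbar + 3%:R * b)%:PP * dd * ll
  + (- (3%:R / 2%:R) * bbar + 3%:R * b)%:PP * ll ^+ 2
  + (3%:R * bbar ^+ 2 - 3%:R * b * bbar - 3%:R / 2%:R * b ^+ 2)%:PP * dd
  + (3%:R / 2%:R * bbar ^+ 2 + 3%:R * b * bbar - 3%:R * b ^+ 2)%:PP * ll
  + (bbar ^+ 3 - 3%:R / 2%:R * b * bbar ^+ 2 - 3%:R / 2%:R * b ^+ 2 * bbar
     + b ^+ 3)%:PP.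

Definition g3b : {poly {poly R}} := ll - b%:PP.

Definition g3c : {poly {poly R}} :=
  dd * ll - abar%:PP * ll ^+ 2 - b%:PP * dd + (bbar + 2 * b * abar)%:PP * ll
  - (b * bbar + b ^+ 2 * abar)%:PP.

Definition g3d : {poly {poly R}} :=
  dd ^+ 2 * ll + 3%:R%:PP * dd * ll ^+ 2 + 2%:R%:PP * ll ^+ 3
  - b%:PP * dd ^+ 2 + (2 * bbar - 6%:R * b)%:PP * dd * ll
  + (3%:R * bbar - 6%:R * b)%:PP * ll ^+ 2
  + (3%:R * b ^+ 2 - 2 * b * bbar)%:PP * dd
  + (bbar ^+ 2 - 6%:R * b * bbar + 6%:R * b ^+ 2)%:PP * ll
  - (bbar ^+ 2 * b) %:PP + (3%:R * b ^+ 2 * bbar)%:PP - (2 * b ^+ 3)%:PP.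
End Polys.

(* Main.v *)
(** Evaluating the L-L identity at [l = 0] exhibits [f] as the coboundary of
    [- f(d, 0) / (be - bbar)], and coboundaries do not change [g]; the L-W
    identity at [l = 0] gives [(be - bbar + b) g = 0].

    When [be - bbar + b = 0], the substitution [d + bbar], [lambda - b] makes the
    L-W identity homogeneous. Its linear part in [l] is an Euler operator, so the
    shifted [g] is homogeneous of degree [n = al - abar + a - 1]; the higher powers
    of [l] give two-term recurrences between its coefficients. Three consecutive
    coefficients satisfy three such recurrences (orders 2 and 3), whose determinant
    is quadratic in the position with leading coefficient [al != 0]; hence it
    vanishes at most twice, which kills everything in degree at least 4. The
    degrees 0 to 3 are solved by hand. *)

Require Import Defs.
From HB Require Import structures.
From mathcomp Require Import all_boot all_order all_algebra.
From mathcomp Require Import ring.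
Import Order.TTheory GRing.Theory Num.Theory.
Local Open Scope ring_scope.

(** * Proving polynomial identities pointwise *)

(** Most identities below are reached through it: [c] is the multiplier that carries a known
    identity to the goal, and only a [ring] or [field] check remains. *)
Lemma eq_of_sub (R : pzRingType) (c x y z t : R) :
  z = t -> x - y = c * (z - t) -> x = y.
Proof. by move=> -> /eqP; rewrite subrr mulr0 subr_eq0 => /eqP. Qed.

(** Stated for a sequence in any domain, so that the sample points can be the naturals in [R] or,
    for two-variable polynomials, the constant polynomials in [{poly R}]. *)
Lemma poly_eq0_on_injseq (S : idomainType) (s : nat -> S) (P : {poly S}) :
  injective s -> (forall i, P.[s i] = 0) -> P = 0.
Proof.
move=> s_inj P0; apply: (@roots_geq_poly_eq0 _ _ [seq s i | i <- iota 0 (size P)]).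
- by apply/allP => _ /mapP[i _ ->]; apply/rootP.
- by rewrite map_inj_uniq ?iota_uniq.
- by rewrite size_map size_iota.
Qed.

Lemma natr_inj (R : numDomainType) : injective (fun i : nat => i%:R : R).
Proof. by move=> i j /eqP; rewrite eqr_nat => /eqP. Qed.

Lemma horner_inj (R : numDomainType) (P Q : {poly R}) :
  (forall x, P.[x] = Q.[x]) -> P = Q.
Proof.
move=> PQ; apply/subr0_eq/(poly_eq0_on_injseq _ _ _ (@natr_inj R)) => i.
by rewrite !hornerE PQ subrr.
Qed.

Lemma ev2_inj (R : numClosedFieldType) (P Q : {poly {poly R}}) :
  (forall m, ev2 P m = ev2 Q m) -> P = Q.
Proof.
move=> PQ; have inj : injective (fun i : nat => (i%:R : R)%:P).
  by move=> i j /polyC_inj/natr_inj.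
apply/subr0_eq/(poly_eq0_on_injseq _ _ _ inj) => i.
by rewrite !hornerE -/(ev2 P _) PQ subrr.
Qed.

Lemma ev2_horner_inj (R : numClosedFieldType) (P Q : {poly {poly R}}) :
  (forall m x, (ev2 P m).[x] = (ev2 Q m).[x]) -> P = Q.
Proof. by move=> PQ; apply: ev2_inj => m; apply: horner_inj. Qed.

Lemma horner_shp (R : numClosedFieldType) (c : R) (p : {poly R}) (x : R) :
  (shp c p).[x] = p.[x + c].
Proof. by rewrite /shp horner_comp !hornerE. Qed.

(** * Module axioms, coboundaries and equivalence *)

(** By sesquilinearity it suffices to test [v_alpha]: for a general vector the identity is
    multiplied by [q(x + l + m)]. The W-L axiom is the negated L-W axiom with [l] and [m] exchanged,
    and the W-W axiom is automatic because W kills [v_abar]. *)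
Lemma is_extP (R : numClosedFieldType) (a b al be abar bbar : R)
    (f g : {poly {poly R}}) :
  is_ext a b al be abar bbar f g <->
  (forall l m x : R,
     (x + l + al * m + be) * (ev2 f l).[x]
     + (x + abar * l + bbar) * (ev2 f m).[x + l]
     - ((x + m + al * l + be) * (ev2 f m).[x]
        + (x + abar * m + bbar) * (ev2 f l).[x + m])
     = (l - m) * (ev2 f (l + m)).[x]) /\
  (forall l m x : R,
     (x + abar * l + bbar) * (ev2 g m).[x + l]
     - (x + m + al * l + be) * (ev2 g m).[x]
     = ((a - 1) * l - m + b) * (ev2 g (l + m)).[x]).
Proof.
split=> [ext|[ff gg] l m [p q]].
  split=> l m x; have [LL LW _ _] := ext l m (0, 1).
    move: LL => [] /(congr1 (horner^~ x)) /= + _.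
    by rewrite !(hornerE, horner_shp) /= => E; apply: (eq_of_sub _ 1 _ _ _ _ E); ring.
  move: LW => [] /(congr1 (horner^~ x)) /= + _.
  rewrite !(hornerE, horner_shp) /= => E; apply: (eq_of_sub _ 1 _ _ _ _ E); ring.
have swap (y : R) : y + l + m = y + (l + m) by ring.
have swap' (y : R) : y + m + l = y + (l + m) by ring.
split; congr pair; apply: horner_inj => x;
  rewrite /subE /actL /actW /scE /= !(hornerE, horner_shp) /= ?swap ?swap'.
- apply: (eq_of_sub _ q.[x + (l + m)] _ _ _ _ (ff l m x)); ring.
- ring.
- apply: (eq_of_sub _ q.[x + (l + m)] _ _ _ _ (gg l m x)); ring.
- ring.
- have := gg m l x; rewrite [m + l]addrC => E.
  apply: (eq_of_sub _ (- q.[x + (l + m)]) _ _ _ _ E); ring.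
- ring.
- ring.
- ring.
Qed.

(** The equivalence sends [v_alpha] to [v_alpha + h v_abar]; [g] survives unchanged because W kills
    [v_abar]. *)
Lemma ext_equiv_coboundary (R : numClosedFieldType) (al be abar bbar : R)
    (f f' g : {poly {poly R}}) (h : {poly R}) :
  (forall l x : R, (ev2 f' l).[x] = (ev2 f l).[x] + (x + al * l + be) * h.[x]
                                  - (x + abar * l + bbar) * h.[x + l]) ->
  ext_equiv al be abar bbar f g f' g.
Proof.
move=> f'E; exists (fun v => (v.1 + v.2 * h, v.2)); split=> //=; last first.
  by move=> p; rewrite mul0r addr0.
split=> [v w|c v|v|l v|l v];
  rewrite /addE /scE /dE /actL /actW /=; congr pair; try ring.
apply: horner_inj => x; rewrite !(hornerE, horner_shp) f'E /=; ring.
Qed.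

(** [L_0 - d] acts on the two ends by the scalars [bbar] and [be]. As these differ, adding a
    multiple of [v_abar] turns [v_alpha] into an eigenvector; [h] is minus that correction. *)
Lemma ext_equiv_split (R : numClosedFieldType) (a b al be abar bbar : R)
    (f g : {poly {poly R}}) :
  be != bbar -> is_ext a b al be abar bbar f g ->
  ext_equiv al be abar bbar f g 0 g.
Proof.
rewrite -subr_eq0 => nz /is_extP[ff _].
pose h : {poly R} := (- (be - bbar)^-1) *: ev2 f 0.
apply: (@ext_equiv_coboundary _ _ _ _ _ _ _ _ h) => l x.
have := ff 0 l x; rewrite add0r addr0 (_ : ev2 0 l = 0) ?/h ?hornerE => [E|]; last exact: horner0.
apply: (eq_of_sub _ (be - bbar)^-1 _ _ _ _ E) => /=; field; exact: nz.
Qed.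

(** W sees only the [v_alpha] component and lands in the submodule, and an equivalence alters
    neither. So [g] is an invariant of the class, which yields nontriviality for [g != 0]. *)
Lemma ext_equiv_W (R : numClosedFieldType) (al be abar bbar : R)
    (f g f' g' : {poly {poly R}}) :
  ext_equiv al be abar bbar f g f' g' -> g = g'.
Proof.
move=> [phi [[_ _ _ _ phiW] phi1 phi2]]; apply: ev2_inj => m.
move: (phiW m (0, 1)); rewrite /actW phi1 phi2 /= => -[].
by rewrite /shp /= !comp_polyC !mul1r.
Qed.

(** * Vanishing of the coefficients in degree at least 4 *)

Section Symbol.
Variables (R : numFieldType) (u A : R) (e : nat -> nat -> R).
(** In the application [u] is [abar], [A] is [a - 1], and [e p q] is [p! q!] times the coefficient
    of [d^p lambda^q] in the shifted [g]. [E2] and [E3] come from the powers [l^2] and [l^3]. *)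
Hypothesis E2 : forall p q : nat,
  (p%:R + 2%:R * u) * e p.+1 q = (2%:R * A - q%:R) * e p q.+1.
Hypothesis E3 : forall p q : nat,
  (p%:R + 3%:R * u) * e p.+2 q = (3%:R * A - q%:R) * e p q.+2.

(* Determinant of the relations [E2 p.+1 q], [E2 p q.+1], [E3 p q], linear in
   [e p.+2 q], [e p.+1 q.+1], [e p q.+2]. *)
Let det (p q : nat) : R :=
  (3%:R * A - q%:R) * (p%:R + 2%:R * u) * (p%:R + 1 + 2%:R * u)
  - (p%:R + 3%:R * u) * (2%:R * A - q%:R - 1) * (2%:R * A - q%:R).

Lemma eq0_det (p q : nat) : det p q != 0 ->
  [/\ e p.+2 q = 0, e p.+1 q.+1 = 0 & e p q.+2 = 0].
Proof.
move=> nz; pose P := p%:R : R; pose Q := q%:R : R.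
have e20 : (P + 1 + 2%:R * u) * e p.+2 q - (2%:R * A - Q) * e p.+1 q.+1 = 0.
  by rewrite natr1 E2 subrr.
have e21 : (P + 2%:R * u) * e p.+1 q.+1 - (2%:R * A - Q - 1) * e p q.+2 = 0.
  by rewrite E2 -[q.+1%:R]natr1 opprD addrA subrr.
have e3 : (P + 3%:R * u) * e p.+2 q - (3%:R * A - Q) * e p q.+2 = 0.
  by rewrite E3 subrr.
(* Cramer's rule: [r], [s], [t] will be, up to sign, the cofactors of the column of the unknown
   [y]. *)
have kill (y r s t : R) :
    det p q * y = r * ((P + 1 + 2%:R * u) * e p.+2 q - (2%:R * A - Q) * e p.+1 q.+1)
     + s * ((P + 2%:R * u) * e p.+1 q.+1 - (2%:R * A - Q - 1) * e p q.+2)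
     + t * ((P + 3%:R * u) * e p.+2 q - (3%:R * A - Q) * e p q.+2) -> y = 0.
  by rewrite e20 e21 e3 !mulr0 !addr0 => /eqP; rewrite mulf_eq0 (negPf nz) => /eqP.
rewrite /det -/P -/Q in kill.
split.
- apply: (kill _ ((3%:R * A - Q) * (P + 2%:R * u)) ((3%:R * A - Q) * (2%:R * A - Q))
    (- ((2%:R * A - Q) * (2%:R * A - Q - 1)))); ring.
- apply: (kill _ ((P + 3%:R * u) * (2%:R * A - Q - 1)) ((3%:R * A - Q) * (P + 1 + 2%:R * u))
    (- ((P + 1 + 2%:R * u) * (2%:R * A - Q - 1)))); ring.
- apply: (kill _ ((P + 3%:R * u) * (P + 2%:R * u)) ((P + 3%:R * u) * (2%:R * A - Q))
    (- ((P + 1 + 2%:R * u) * (P + 2%:R * u)))); ring.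
Qed.

(** With [p + q] fixed the cubic terms of [det] cancel, so the second difference is twice a leading
    coefficient. Here [p + q + 4] is the degree of the coefficients [e] involved, so by
    [cocycle_homogeneous] that leading coefficient will be [al]. *)
Lemma det_second_difference (p q : nat) :
  det p.+2 q - 2%:R * det p.+1 q.+1 + det p q.+2
  = 2%:R * ((p + q + 4)%:R + u - A).
Proof.
rewrite /det !natrD.
rewrite -[p.+2%:R]natr1 -[p.+1%:R]natr1 -[q.+2%:R]natr1 -[q.+1%:R]natr1; ring.
Qed.

Lemma det_neq0 (p q : nat) : (p + q + 4)%:R + u - A != 0 ->
  [\/ det p.+2 q != 0, det p.+1 q.+1 != 0 | det p q.+2 != 0].
Proof.
move=> nz; case: (eqVneq (det p.+2 q) 0) => [d0|]; last by constructor 1.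
case: (eqVneq (det p.+1 q.+1) 0) => [d1|]; last by constructor 2.
constructor 3; apply: contraNneq nz => d2; move: (det_second_difference p q).
rewrite d0 d1 d2 mulr0 subr0 addr0 => /esym/eqP.
by rewrite mulf_eq0 pnatr_eq0.
Qed.

(** Two affine functions of [t] with nonzero resultant have no common root. This settles the
    coefficients near the ends, where [E2] and [E3] have a vanishing side, without any case
    distinction on [u] or [A]. *)
Lemma mulr_eq0_resultant (n : nat) (r s r' s' t y : R) :
  (r + s * t) * y = 0 -> (r' + s' * t) * y = 0 ->
  s' * r - s * r' = n.+1%:R -> y = 0.
Proof.
move=> h h' res; have : n.+1%:R * y = 0.
  rewrite -res; apply: etrans (_ : s' * ((r + s * t) * y) - s * ((r' + s' * t) * y) = _).
    by ring.
  by rewrite h h' !mulr0 subrr.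
by move/eqP; rewrite mulf_eq0 pnatr_eq0 => /eqP.
Qed.

Lemma degree_ge4_eq0 (p q : nat) : (4 <= p + q)%N -> (p + q)%:R + u - A != 0 ->
  e p q = 0.
Proof.
(* Each of the three windows offered by [det_neq0] contains the position [(r + 2, s + 2)]. *)
have mid r s : (r + s + 4)%:R + u - A != 0 -> e r.+2 s.+2 = 0.
  by move/det_neq0=> [] /eq0_det [].
have e1 r : (r + 4)%:R + u - A != 0 -> e r.+3 1%N = 0.
  move=> nz; have e2 : e r.+2 2%N = 0 by apply: mid; rewrite addn0.
  apply/eqP/negPn/negP => e1_neq0.
  have e3 : e r.+1 3%N = 0.
    (* Only in degree 4 is [(1, 3)] out of reach of [mid]. There two of the windows contain
       [(3, 1)], contradicting [e1_neq0], and the third contains [(1, 3)]. *)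
    case: r => [|r] in nz e2 e1_neq0 *; last by apply: mid; rewrite addn1 addSn.
    case: (@det_neq0 0 0) => // /eq0_det[] //;
      by move=> *; move: e1_neq0; rewrite (_ : e 3 1 = 0) ?eqxx.
  move/eqP: e1_neq0; apply; apply: (@mulr_eq0_resultant r.+3 r.+2%:R 2%:R r.+1%:R 3%:R u).
  - by rewrite E2 e2 mulr0.
  - by rewrite E3 e3 mulr0.
  - by rewrite -[r.+4%:R]natr1 -[r.+3%:R]natr1 -[r.+2%:R]natr1 -[r.+1%:R]natr1; ring.
have e1' s : (s + 4)%:R + u - A != 0 -> e 1%N s.+3 = 0.
  move=> nz; have e2 : e 2%N s.+2 = 0 by apply: mid.
  have e3 : e 3%N s.+1 = 0.
    (* In degree 4 the entry [(3, 1)] is again out of reach of [mid], but [e1] has just settled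
       it. *)
    by case: s nz {e2} => [|s] nz; [exact: e1 | apply: mid; rewrite add1n].
  apply: (@mulr_eq0_resultant s.+3 (- s.+1%:R) 3%:R (- s.+2%:R) 2%:R A).
  - by rewrite addrC -E3 e3 mulr0.
  - by rewrite addrC -E2 e2 mulr0.
  - by rewrite -[s.+4%:R]natr1 -[s.+3%:R]natr1 -[s.+2%:R]natr1 -[s.+1%:R]natr1; ring.
have e0 r : (r + 4)%:R + u - A != 0 -> e r.+4 0%N = 0.
  move=> nz; apply: (@mulr_eq0_resultant r.+4 r.+3%:R 2%:R r.+2%:R 3%:R u).
  - by rewrite E2 e1 ?mulr0.
  - by rewrite E3 mid ?mulr0 ?addn0.
  - by rewrite -[r.+4.+1%:R]natr1 -[r.+4%:R]natr1 -[r.+3%:R]natr1 -[r.+2%:R]natr1; ring.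
have e0' s : (s + 4)%:R + u - A != 0 -> e 0%N s.+4 = 0.
  move=> nz; apply: (@mulr_eq0_resultant s.+4 (- s.+2%:R) 3%:R (- s.+3%:R) 2%:R A).
  - by rewrite addrC -E3 mid ?mulr0.
  - by rewrite addrC -E2 e1' ?mulr0.
  - by rewrite -[s.+4.+1%:R]natr1 -[s.+4%:R]natr1 -[s.+3%:R]natr1 -[s.+2%:R]natr1; ring.
case: p => [|[|p]] le4 nz.
- by case: q le4 nz => [|[|[|[|q]]]] // _; rewrite -addn4 add0n => /e0'; rewrite addn4.
- by case: q le4 nz => [|[|[|q]]] // _; rewrite add1n -addn4 => /e1'.
- case: q le4 nz => [|[|q]].
  + by case: p => [|[|p]] // _; rewrite addn0 -addn4 => /e0; rewrite addn4.
  + by case: p => [|p] // _; rewrite addn1 -addn4 => /e1.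
  + by rewrite (_ : (p.+2 + q.+2 = p + q + 4)%N) => [_ /mid //|]; rewrite !addSn !addnS addn0.
Qed.
End Symbol.

(** * Coefficient relations of the shifted L-W identity *)

Lemma coef_comp_polyXaddC (R : numDomainType) (p : {poly R}) (c : R) (j : nat) :
  (p \Po ('X + c%:P))`_j = p^`N(j).[c].
Proof.
have -> : p \Po ('X + c%:P) = \poly_(i < size p) p^`N(i).[c].
  apply: horner_inj => x; rewrite horner_comp horner_poly !hornerE addrC.
  exact/nderiv_taylor/mulrC.
by rewrite coef_poly; case: ltnP => // lep; rewrite nderivn_poly0 // horner0.
Qed.

Section Cocycle.
Variables (R : numClosedFieldType) (u A al : R) (G : {poly {poly R}}).
Hypothesis cocycle : forall l m x : R,
  (x + u * l) * (ev2 G m).[x + l] - (x + m + al * l) * (ev2 G m).[x]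
  = (A * l - m) * (ev2 G (l + m)).[x].

Let c (p q : nat) : R := G`_q`_p.

(** This is the coefficient of [l^(k+1) x^p m^q]. The constant term in [l] is trivial, hence the
    offset; [al] enters only the linear part, [k = 0]. *)
Lemma coef_cocycle (k p q : nat) :
  c (k + p) q * 'C(k + p, k.+1)%:R + u * (c (k + p) q * 'C(k + p, k)%:R)
  - (if k == 0%N then al * c p q else 0)
  - A * (c p (k + q) * 'C(k + q, k)%:R) + c p (k + q) * 'C(k + q, k.+1)%:R = 0.
Proof.
(* [D1] and [D2] collect the divided derivatives of [G] in [d] and in [lambda]: the Taylor
   coefficients of [G(x + l, m)] and [G(x, l + m)] in [l]. *)
pose D1 i := swapXY ((swapXY G)^`N(i)); pose D2 i := G^`N(i).
have D1E i m x : (D1 i).[m%:P].[x] = ((ev2 G m)^`N(i)).[x].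
  rewrite /ev2 /D1 !horner_polyC swapXYK.
  by rewrite nderivn_map.
have D2E i m x : (D2 i).[m%:P].[x] = ((map_poly (horner_eval x) G)^`N(i)).[m].
  by rewrite nderivn_map -{2}(hornerC m x) horner_map.
have D0E m x : (ev2 G m).[x] = (map_poly (horner_eval x) G).[m].
  by rewrite -{2}(hornerC m x) horner_map.
have E : 'X%:P * D1 k.+1 + u%:PP * D1 k - (if k == 0%N then al%:PP * G else 0)
         - A%:PP * D2 k + 'X * D2 k.+1 = 0.
  apply: ev2_horner_inj => m x.
  (* For fixed [x] and [m], both sides become polynomials in [l]. *)
  pose Tx := ev2 G m \Po ('X + x%:P).
  pose Ty := map_poly (horner_eval x) G \Po ('X + m%:P).
  have : Tx * x%:P + (Tx * u%:P) * 'X - ((ev2 G m).[x] * (x + m))%:P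
          - ((ev2 G m).[x] * al)%:P * 'X - (Ty * A%:P) * 'X + Ty * m%:P = 0.
    apply: horner_inj => l; rewrite !hornerE !horner_comp !hornerE -D0E.
    apply: (eq_of_sub _ 1 _ _ _ _ (cocycle l m x)).
    rewrite [l + x]addrC; ring.
  move=> /(congr1 (fun p : {poly R} => p`_k.+1)).
  rewrite coef0 !(coefD, coefN, coefMX, coefMC, coefC) /= !coef_comp_polyXaddC.
  rewrite /ev2 horner0 => E; apply: (eq_of_sub _ 1 _ _ _ _ E).
  rewrite !hornerE /= !D1E !D2E; case: eqP => _; rewrite !hornerE /=; ring.
have D1c i r : (D1 i)`_q`_r = c (i + r) q * 'C(i + r, i)%:R.
  by rewrite coef_swapXY coef_nderivn coefMn coef_swapXY mulr_natr.
have D2c i r : (D2 i)`_r`_p = c p (i + r) * 'C(i + r, i)%:R.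
  by rewrite coef_nderivn coefMn mulr_natr.
move: E => /(congr1 (fun P : {poly {poly R}} => P`_q`_p)).
rewrite !coef0 !(coefD, coefN, coefCM, coefXM) !D1c D2c => E.
apply: etrans E; congr (_ + _ - _ - _ + _).
(* At index 0 a factor ['X] contributes nothing, in agreement with ['C(k, k+1) = 0]. *)
- by case: p D2c => [|r] _ /=; [rewrite addn0 bin_small ?mulr0 | rewrite addSnnS].
- by case: eqP; rewrite ?coef0 // !coefCM.
- by case: q D1c => [|r] _ /=; [rewrite coef0 addn0 bin_small ?mulr0 | rewrite D2c addSnnS].
Qed.

(** For [k = 0] the relation is diagonal: [(p + q + u - A - al) c p q = 0], the Euler operator. *)
Lemma cocycle_homogeneous (p q : nat) : c p q != 0 -> al = (p + q)%:R + u - A.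
Proof.
move=> nz; have := coef_cocycle 0 p q.
rewrite eqxx !add0n !bin1 !bin0 natrD => E.
by apply/(mulfI nz)/(eq_of_sub _ (-1) _ _ _ _ E); ring.
Qed.

(* The divided-power normalization turns the binomial coefficients of
   [coef_cocycle] into integers. *)
Definition scaled_coef (p q : nat) : R := c p q * p`!%:R * q`!%:R.

(** The absorption identity [r C(k+r, k) = (k+1) C(k+r, k+1)] merges the two binomials attached to
    each variable. *)
Lemma scaled_coef_rel (k p q : nat) : (0 < k)%N ->
  (p%:R + k.+1%:R * u) * scaled_coef (k + p) q
  = (k.+1%:R * A - q%:R) * scaled_coef p (k + q).
Proof.
move=> k_gt0; have := coef_cocycle k p q; rewrite gtn_eqF //.
have factE r : (k + r)`!%:R = 'C(k + r, k)%:R * k`!%:R * r`!%:R :> R.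
  by rewrite -(bin_fact (leq_addr r k)) addKn !natrM mulrA.
have binE r : r%:R * 'C(k + r, k)%:R = k.+1%:R * 'C(k + r, k.+1)%:R :> R.
  by rewrite -!natrM mul_bin_left addKn.
rewrite /scaled_coef !factE.
have := binE p; have := binE q.
move: k.+1%:R p%:R q%:R k`!%:R p`!%:R q`!%:R 'C(k + p, k)%:R 'C(k + q, k)%:R.
move: 'C(k + p, k.+1)%:R 'C(k + q, k.+1)%:R => C1 C2 K P Q kf pf qf B B' Q_ P_ E.
apply: (eq_of_sub _ (K * kf * pf * qf) _ _ _ _ E); ring: P_ Q_.
Qed.

Lemma ev2_homogeneous (n : nat) :
  (forall p q, c p q != 0 -> (p + q)%N = n) ->
  forall m x, (ev2 G m).[x]
    = \sum_(q < n.+1) c (n - q)%N q * x ^+ (n - q) * m ^+ q.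
Proof.
move=> hom m x.
have -> : G = \poly_(q < n.+1) (c (n - q)%N q *: 'X^(n - q)).
  apply/polyP => q; apply/polyP => p; rewrite -/(c p q) coef_poly.
  have [lqn|ltnq] := ltnP q n.+1; rewrite ?coefZ ?coefXn ?coef0.
    have [->|ne] := eqVneq p (n - q)%N; first by rewrite mulr1.
    rewrite mulr0; apply/eqP; apply: contraNT ne => /hom <-; by rewrite addnK.
  apply/eqP; apply: contraTT ltnq => /hom <-; by rewrite -leqNgt leq_addl.
rewrite /ev2 horner_poly horner_sum; apply: eq_bigr => q _.
by rewrite hornerM hornerZ hornerXn -polyC_exp hornerC.
Qed.
End Cocycle.

(** * Homogeneous forms and the reduction of an extension to one *)

(** The binary form with divided-power coefficients [e]; the factorials undo the scaling of
    [scaled_coef]. *)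
Definition symbol (R : numFieldType) (e : nat -> nat -> R) (n : nat) (x m : R) : R :=
  \sum_(q < n.+1) e (n - q)%N q / (n - q)`!%:R / q`!%:R * x ^+ (n - q) * m ^+ q.

Section LowDegree.
Variables (R : numFieldType) (e : nat -> nat -> R) (x m : R).
Lemma symbol0 : symbol R e 0 x m = e 0%N 0%N.
Proof.
rewrite /symbol big_ord1 /= subn0 fact0; field; by rewrite ?pnatr_eq0 ?oner_neq0.
Qed.

Lemma symbol1 : symbol R e 1 x m = e 1%N 0%N * x + e 0%N 1%N * m.
Proof.
rewrite /symbol !big_ord_recl big_ord0 /bump /=.
rewrite !(subnn, subn0, subSS, addn0, factS, fact0); field; by rewrite ?pnatr_eq0 ?oner_neq0.
Qed.

Lemma symbol2 : symbol R e 2 x m =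
  e 2%N 0%N / 2%:R * x ^+ 2 + e 1%N 1%N * x * m + e 0%N 2%N / 2%:R * m ^+ 2.
Proof.
rewrite /symbol !big_ord_recl big_ord0 /bump /=.
rewrite !(subnn, subn0, subSS, addn0, factS, fact0); field; by rewrite ?pnatr_eq0 ?oner_neq0.
Qed.

Lemma symbol3 : symbol R e 3 x m =
  e 3%N 0%N / 6%:R * x ^+ 3 + e 2%N 1%N / 2%:R * x ^+ 2 * m
  + e 1%N 2%N / 2%:R * x * m ^+ 2 + e 0%N 3%N / 6%:R * m ^+ 3.
Proof.
rewrite /symbol !big_ord_recl big_ord0 /bump /=.
rewrite !(subnn, subn0, subSS, addn0, factS, fact0); field; by rewrite ?pnatr_eq0 ?oner_neq0.
Qed.
End LowDegree.

(** Reduces the classification to linear algebra on at most four coefficients. The bound [n < 4]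
    uses [al != 0] through [degree_ge4_eq0]. *)
Lemma ext_symbol (R : numClosedFieldType) (a b al be abar bbar : R)
    (g : {poly {poly R}}) :
  be - bbar + b = 0 -> al != 0 -> g != 0 -> is_ext a b al be abar bbar 0 g ->
  exists (n : nat) (e : nat -> nat -> R),
  [/\ (n < 4)%N,
      al = n%:R + abar - (a - 1),
      forall k p q : nat, (0 < k)%N ->
        (p%:R + k.+1%:R * abar) * e (k + p)%N q
        = (k.+1%:R * (a - 1) - q%:R) * e p (k + q)%N,
      (exists2 q, (q <= n)%N & e (n - q)%N q != 0)
    & forall m x : R, (ev2 g m).[x] = symbol R e n (x + bbar) (m - b)].
Proof.
move=> hb al0 g0 /is_extP[_ gg].
(* [G(x, m) = g(x - bbar, m + b)]; since [be = bbar - b], all the constants leave the identity. *)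
pose G := map_poly (comp_poly ('X - bbar%:P)) g \Po ('X + b%:PP).
have GE m x : (ev2 G m).[x] = (ev2 g (m + b)).[x - bbar].
  rewrite /G /ev2 horner_comp !hornerE -polyCD -{1}(comp_polyC (m + b) ('X - bbar%:P)).
  by rewrite horner_map /= horner_comp !hornerE.
have gE m x : (ev2 g m).[x] = (ev2 G (m - b)).[x + bbar] by rewrite GE addrNK addrK.
have cocG l m x : (x + abar * l) * (ev2 G m).[x + l] - (x + m + al * l) * (ev2 G m).[x]
  = ((a - 1) * l - m) * (ev2 G (l + m)).[x].
  rewrite !GE -[l + m + b]addrA [x + l - bbar]addrAC.
  have beE : be = bbar - b by apply/eqP; rewrite -subr_eq0 opprB addrA addrAC hb.
  apply: (eq_of_sub _ 1 _ _ _ _ (gg l (m + b) (x - bbar))); rewrite beE; ring.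
have [p0 [q0 c0]] : exists p q, G`_q`_p != 0.
  have G0 : G != 0.
    apply: contraNneq g0 => G0; apply/eqP/ev2_horner_inj => m x.
    by rewrite gE G0 /ev2 !horner0.
  (* The leading coefficient of the leading coefficient is nonzero. *)
  exists (size (lead_coef G)).-1, (size G).-1.
  by rewrite -/(lead_coef G) -/(lead_coef _) !lead_coef_eq0.
have alE := @cocycle_homogeneous _ _ _ _ _ cocG.
have rel := @scaled_coef_rel _ _ _ _ _ cocG.
exists (p0 + q0)%N, (scaled_coef _ G); split=> //.
- rewrite ltnNge; apply/negP => le4.
  have : scaled_coef _ G p0 q0 = 0.
    apply: (@degree_ge4_eq0 _ abar (a - 1)) => // [p q|p q|].
    + by have := rel 1%N p q isT; rewrite !add1n.
    + by have := rel 2%N p q isT; rewrite !add2n.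
    (* The quantity required to be nonzero is [al] itself. *)
    + by rewrite -(alE _ _ c0).
  by move/eqP; rewrite /scaled_coef !mulf_eq0 !pnatr_eq0 (negPf c0) !gtn_eqF ?fact_gt0.
- exact: alE.
- exists q0; rewrite ?leq_addl // addnK /scaled_coef.
  by rewrite !mulf_neq0 // pnatr_eq0 gtn_eqF ?fact_gt0.
- move=> m x; rewrite gE (@ev2_homogeneous _ _ (p0 + q0)) => [|p q].
    rewrite /symbol; apply: eq_bigr => q _; congr (_ * _ * _); rewrite /scaled_coef mulrAC.
    by rewrite !mulfK // pnatr_eq0 gtn_eqF ?fact_gt0.
  move/alE; rewrite (alE _ _ c0) => /addIr/addIr/eqP.
  by rewrite eqr_nat => /eqP.
Qed.

(** * The listed polynomials in the shifted variables *)

Section Values.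
Variables (R : numClosedFieldType) (a b abar bbar m x : R).

Let hornerE2 := (hornerD, hornerN, hornerM, horner_exp, hornerC, hornerX).

Lemma ev2_scale (c : R) (g : {poly {poly R}}) :
  (ev2 (c%:PP * g) m).[x] = c * (ev2 g m).[x].
Proof. by rewrite /ev2 !hornerE2. Qed.

(** In [x + bbar] and [m - b] this and the following polynomials become homogeneous, ready for
    comparison with [symbol]. *)
Lemma ev2_g2b : (ev2 (g2b a b abar bbar) m).[x] =
  (x + bbar) - abar / (1 - a) * (m - b).
Proof. rewrite /ev2 /g2b !hornerE2; ring. Qed.

Lemma ev2_g2c : (ev2 (g2c a b abar bbar) m).[x] =
  (x + bbar) ^+ 2 - (1 + 2%:R * abar) / (1 - a) * (x + bbar) * (m - b)
  - abar / (1 - a) * (m - b) ^+ 2.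
Proof. rewrite /ev2 /g2c !hornerE2; ring. Qed.

Lemma ev2_g2d : (ev2 (g2d b bbar) m).[x] =
  (x + bbar) ^+ 3 + 3%:R / 2%:R * (x + bbar) ^+ 2 * (m - b)
  - 3%:R / 2%:R * (x + bbar) * (m - b) ^+ 2 - (m - b) ^+ 3.
Proof. rewrite /ev2 /g2d !hornerE2; by field. Qed.

Lemma ev2_g3b : (ev2 (g3b b) m).[x] = m - b.
Proof. by rewrite /ev2 /g3b !hornerE2. Qed.

Lemma ev2_g3c : (ev2 (g3c b abar bbar) m).[x] =
  (x + bbar) * (m - b) - abar * (m - b) ^+ 2.
Proof. rewrite /ev2 /g3c !hornerE2; ring. Qed.

Lemma ev2_g3d : (ev2 (g3d b bbar) m).[x] =
  (x + bbar) ^+ 2 * (m - b) + 3%:R * (x + bbar) * (m - b) ^+ 2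
  + 2%:R * (m - b) ^+ 3.
Proof. rewrite /ev2 /g3d !hornerE2; ring. Qed.
End Values.

(** * Classification of the nonzero [g] *)

Lemma ext_W_eq0 (R : numClosedFieldType) (a b al be abar bbar : R)
    (f g : {poly {poly R}}) :
  be - bbar + b != 0 -> is_ext a b al be abar bbar f g -> g = 0.
Proof.
move=> nz /is_extP[_ gg]; apply: ev2_horner_inj => m x.
apply: (mulfI nz); have := gg 0 m x; rewrite addr0 add0r => E.
rewrite {2}/ev2 !horner0; apply: (eq_of_sub _ (-1) _ _ _ _ E); ring.
Qed.

(** With [f = 0] the L-L identity is void and the L-W identity is linear in [g]. *)
Lemma is_ext_scale (R : numClosedFieldType) (a b al be abar bbar c : R)
    (g : {poly {poly R}}) :
  (forall l m x : R,
     (x + abar * l + bbar) * (ev2 g m).[x + l]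
     - (x + m + al * l + be) * (ev2 g m).[x]
     = ((a - 1) * l - m + b) * (ev2 g (l + m)).[x]) ->
  is_ext a b al be abar bbar 0 (c%:PP * g).
Proof.
move=> gg; apply/is_extP; split=> l m x.
  by rewrite /ev2 !horner0 !mulr0 !addr0 subr0.
rewrite !ev2_scale; apply: (eq_of_sub _ c _ _ _ _ (gg l m x)); ring.
Qed.

Section Classification.
Variables (R : numClosedFieldType) (a b al be abar bbar : R).
Hypotheses (hb : be - bbar + b = 0) (al0 : al != 0) (abar0 : abar != 0).

(** As [a - 1] is invertible, the relations with [q = 0] express every coefficient through [e n 0],
    so [g] is unique up to a scalar. The relations with [q > 0] then constrain [abar] and [a]. *)
Lemma classify_a_neq1 (g : {poly {poly R}}) : a != 1 -> g != 0 ->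
  is_ext a b al be abar bbar 0 g ->
  exists2 c : R, c != 0 &
    [\/ al - abar = 1 - a /\ g = c%:PP,
        al - abar = 2 - a /\ g = c%:PP * g2b a b abar bbar,
        [/\ al = 1, abar = a - 2 & g = c%:PP * g2c a b abar bbar]
      | [/\ al = 5%:R / 3%:R, a = 5%:R / 3%:R, abar = - (2%:R / 3%:R)
          & g = c%:PP * g2d b bbar]].
Proof.
move=> a1 g0 /(ext_symbol _ _ _ _ _ _ _ _ hb al0 g0)
  [n [e [n4 alE rel [q1 leq1 e0] gE]]].
have A0 : a - 1 != 0 by rewrite subr_eq0.
have k0 : 1 - a != 0 by rewrite subr_eq0 eq_sym.
case: n => [|[|[|[|n]]]] // in n4 alE leq1 e0 gE.
- case: q1 leq1 e0 => // _ e0; exists (e 0 0)%N => //; constructor 1.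
  split; first by rewrite alE; ring.
  apply: ev2_horner_inj => m x; by rewrite gE symbol0 /ev2 !hornerE.
- have r0 : (0%:R + 2%:R * abar) * e 1%N 0%N = (2%:R * (a - 1) - 0%:R) * e 0%N 1%N
    := rel 1%N 0%N 0%N isT.
  have e01 : e 0%N 1%N = abar / (a - 1) * e 1%N 0%N.
    by apply: (mulfI A0); apply: (eq_of_sub _ (- 2%:R^-1) _ _ _ _ r0); by field.
  exists (e 1 0)%N; last constructor 2.
    apply: contraNneq e0 => e10.
    by case: q1 leq1 => [|[|]] //= _; rewrite ?e01 e10 ?mulr0.
  split; first by rewrite alE; ring.
  apply: ev2_horner_inj => m x; rewrite gE symbol1 e01.
  rewrite ev2_scale ev2_g2b; field.
  by rewrite A0 k0.
- have r0 : (1%:R + 2%:R * abar) * e 2%N 0%N = (2%:R * (a - 1) - 0%:R) * e 1%N 1%N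
    := rel 1%N 1%N 0%N isT.
  have r1 : (0%:R + 2%:R * abar) * e 1%N 1%N = (2%:R * (a - 1) - 1%:R) * e 0%N 2%N
    := rel 1%N 0%N 1%N isT.
  have r2 : (0%:R + 3%:R * abar) * e 2%N 0%N = (3%:R * (a - 1) - 0%:R) * e 0%N 2%N
    := rel 2%N 0%N 0%N isT.
  have e11 : e 1%N 1%N = (1 + 2%:R * abar) / (2%:R * (a - 1)) * e 2%N 0%N.
    by apply: (mulfI A0); apply: (eq_of_sub _ (- 2%:R^-1) _ _ _ _ r0); by field.
  have e02 : e 0%N 2%N = abar / (a - 1) * e 2%N 0%N.
    by apply: (mulfI A0); apply: (eq_of_sub _ (- 3%:R^-1) _ _ _ _ r2); by field.
  have e20 : e 2%N 0%N != 0.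
    apply: contraNneq e0 => e20.
    by case: q1 leq1 => [|[|[|]]] //= _; rewrite ?e11 ?e02 e20 ?mulr0.
  have abarE : abar = a - 2.
    apply/(mulfI abar0)/(mulfI e20); rewrite e11 e02 in r1.
    by apply: (eq_of_sub _ ((a - 1) / 2%:R) _ _ _ _ r1); by field.
  exists (e 2 0 / 2%:R)%N; first by rewrite mulf_neq0 ?invr_eq0 ?pnatr_eq0.
  constructor 3; split=> //; first by rewrite alE abarE; ring.
  apply: ev2_horner_inj => m x; rewrite gE symbol2 e11 e02.
  rewrite ev2_scale ev2_g2c; field.
  by rewrite A0 k0.
- have r0 : (2%:R + 2%:R * abar) * e 3%N 0%N = (2%:R * (a - 1) - 0%:R) * e 2%N 1%N
    := rel 1%N 2%N 0%N isT.
  have r1 : (1%:R + 2%:R * abar) * e 2%N 1%N = (2%:R * (a - 1) - 1%:R) * e 1%N 2%N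
    := rel 1%N 1%N 1%N isT.
  have r2 : (1%:R + 3%:R * abar) * e 3%N 0%N = (3%:R * (a - 1) - 0%:R) * e 1%N 2%N
    := rel 2%N 1%N 0%N isT.
  have r3 : (0%:R + 3%:R * abar) * e 2%N 1%N = (3%:R * (a - 1) - 1%:R) * e 0%N 3%N
    := rel 2%N 0%N 1%N isT.
  have r4 : (0%:R + 4%:R * abar) * e 3%N 0%N = (4%:R * (a - 1) - 0%:R) * e 0%N 3%N
    := rel 3%N 0%N 0%N isT.
  have e21 : e 2%N 1%N = (1 + abar) / (a - 1) * e 3%N 0%N.
    by apply: (mulfI A0); apply: (eq_of_sub _ (- 2%:R^-1) _ _ _ _ r0); by field.
  have e12 : e 1%N 2%N = (1 + 3%:R * abar) / (3%:R * (a - 1)) * e 3%N 0%N.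
    by apply: (mulfI A0); apply: (eq_of_sub _ (- 3%:R^-1) _ _ _ _ r2); by field.
  have e03 : e 0%N 3%N = abar / (a - 1) * e 3%N 0%N.
    by apply: (mulfI A0); apply: (eq_of_sub _ (- 4%:R^-1) _ _ _ _ r4); by field.
  have e30 : e 3%N 0%N != 0.
    apply: contraNneq e0 => e30.
    by case: q1 leq1 => [|[|[|[|]]]] //= _; rewrite ?e21 ?e12 ?e03 e30 ?mulr0.
  have aE : a = abar + 7%:R / 3%:R.
    apply/(mulfI abar0)/(mulfI e30); rewrite e21 e03 in r3.
    by apply: (eq_of_sub _ (- (a - 1) / 3%:R) _ _ _ _ r3); by field.
  have abarE : abar = - (2%:R / 3%:R).
    (* Once [aE] ties [abar] to [a], the quadratic terms of [r1] cancel and a linear equation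
       remains. *)
    apply/(mulfI e30); rewrite e21 e12 in r1.
    apply: (eq_of_sub _ ((a - 1) * 3%:R / 2%:R) _ _ _ _ r1).
    by rewrite (_ : abar = a - 7%:R / 3%:R); [field | rewrite aE addrK].
  have a53 : a = 5%:R / 3%:R by rewrite aE abarE; by field.
  have A23 : a - 1 = 2%:R / 3%:R by rewrite a53; by field.
  have {}e21 : e 2%N 1%N = e 3%N 0%N / 2%:R by rewrite e21 abarE A23; by field.
  have {}e12 : e 1%N 2%N = - (e 3%N 0%N / 2%:R) by rewrite e12 abarE A23; by field.
  have {}e03 : e 0%N 3%N = - e 3%N 0%N by rewrite e03 abarE A23; by field.
  exists (e 3 0 / 6%:R)%N; first by rewrite mulf_neq0 ?invr_eq0 ?pnatr_eq0.
  constructor 4; split=> //; first by rewrite alE abarE a53; by field.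
  apply: ev2_horner_inj => m x; rewrite gE symbol3 e21 e12 e03.
  rewrite ev2_scale ev2_g2d; by field.
Qed.

(** Now [a - 1 = 0], so for [n > 0] the relation with [k = n], [p = q = 0] kills [e n 0]. The other
    coefficients are multiples of [e (n-1) 1], and only degree 3 imposes a condition on [abar]. *)
Lemma classify_a_eq1 (g : {poly {poly R}}) : a = 1 -> g != 0 ->
  is_ext a b al be abar bbar 0 g ->
  exists2 c : R, c != 0 &
    [\/ al = abar /\ g = c%:PP,
        al - abar = 1 /\ g = c%:PP * g3b b,
        al - abar = 2 /\ g = c%:PP * g3c b abar bbar
      | [/\ al = 1, abar = - 2%:R & g = c%:PP * g3d b bbar]].
Proof.
move=> a1 g0 /(ext_symbol _ _ _ _ _ _ _ _ hb al0 g0)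
  [n [e [n4 alE rel [q1 leq1 e0] gE]]].
rewrite a1 subrr subr0 in alE rel.
have top k y t : k.+1%:R * abar * y = t * 0 -> y = 0.
  rewrite mulr0 => /eqP; rewrite !mulf_eq0 (negPf abar0) pnatr_eq0 /=.
  by move/eqP.
case: n => [|[|[|[|n]]]] // in n4 alE leq1 e0 gE.
- case: q1 leq1 e0 => // _ e0; exists (e 0 0)%N => //; constructor 1.
  split; first by rewrite alE; ring.
  apply: ev2_horner_inj => m x; by rewrite gE symbol0 /ev2 !hornerE.
- have r0 : (0%:R + 2%:R * abar) * e 1%N 0%N = (2%:R * 0 - 0%:R) * e 0%N 1%N
    := rel 1%N 0%N 0%N isT.
  have e10 : e 1%N 0%N = 0.
    apply: (top 1%N _ 0); apply: (eq_of_sub _ 1 _ _ _ _ r0); ring.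
  exists (e 0 1)%N; last constructor 2.
    by case: q1 leq1 e0 => [|[|]] //= _; rewrite e10 eqxx.
  split; first by rewrite alE; ring.
  apply: ev2_horner_inj => m x; rewrite gE symbol1 e10.
  rewrite ev2_scale ev2_g3b; by field.
- have r1 : (0%:R + 2%:R * abar) * e 1%N 1%N = (2%:R * 0 - 1%:R) * e 0%N 2%N
    := rel 1%N 0%N 1%N isT.
  have r2 : (0%:R + 3%:R * abar) * e 2%N 0%N = (3%:R * 0 - 0%:R) * e 0%N 2%N
    := rel 2%N 0%N 0%N isT.
  have e20 : e 2%N 0%N = 0.
    apply: (top 2%N _ 0); apply: (eq_of_sub _ 1 _ _ _ _ r2); ring.
  have e02 : e 0%N 2%N = - 2%:R * abar * e 1%N 1%N.
    by apply: (eq_of_sub _ 1 _ _ _ _ r1); ring.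
  exists (e 1 1)%N; last constructor 3.
    apply: contraNneq e0 => e11.
    by case: q1 leq1 => [|[|[|]]] //= _; rewrite ?e20 ?e02 ?e11 ?mulr0.
  split; first by rewrite alE; ring.
  apply: ev2_horner_inj => m x; rewrite gE symbol2 e20 e02.
  rewrite ev2_scale ev2_g3c; by field.
- have r1 : (1%:R + 2%:R * abar) * e 2%N 1%N = (2%:R * 0 - 1%:R) * e 1%N 2%N
    := rel 1%N 1%N 1%N isT.
  have r2 : (0%:R + 2%:R * abar) * e 1%N 2%N = (2%:R * 0 - 2%:R) * e 0%N 3%N
    := rel 1%N 0%N 2%N isT.
  have r3 : (0%:R + 3%:R * abar) * e 2%N 1%N = (3%:R * 0 - 1%:R) * e 0%N 3%N
    := rel 2%N 0%N 1%N isT.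
  have r4 : (0%:R + 4%:R * abar) * e 3%N 0%N = (4%:R * 0 - 0%:R) * e 0%N 3%N
    := rel 3%N 0%N 0%N isT.
  have e30 : e 3%N 0%N = 0.
    apply: (top 3%N _ 0); apply: (eq_of_sub _ 1 _ _ _ _ r4); ring.
  have e03 : e 0%N 3%N = - 3%:R * abar * e 2%N 1%N.
    by apply: (eq_of_sub _ 1 _ _ _ _ r3); ring.
  have e12 : e 1%N 2%N = 3%:R * e 2%N 1%N.
    apply: (mulfI abar0); rewrite e03 in r2.
    by apply: (eq_of_sub _ (2%:R^-1) _ _ _ _ r2); by field.
  have e21 : e 2%N 1%N != 0.
    apply: contraNneq e0 => e21.
    by case: q1 leq1 => [|[|[|[|]]]] //= _; rewrite ?e30 ?e12 ?e03 ?e21 ?mulr0.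
  have abarE : abar = - 2%:R.
    apply/(mulfI e21); rewrite e12 in r1.
    by apply: (eq_of_sub _ (2%:R^-1) _ _ _ _ r1); by field.
  exists (e 2 1 / 2%:R)%N; first by rewrite mulf_neq0 ?invr_eq0 ?pnatr_eq0.
  constructor 4; split=> //; first by rewrite alE abarE; ring.
  apply: ev2_horner_inj => m x; rewrite gE symbol3 e30 e12 e03.
  rewrite abarE ev2_scale ev2_g3d; by field.
Qed.
End Classification.

(** * Converse verification and assembly *)

Lemma ext_const (R : numClosedFieldType) (a b al be abar bbar c : R) :
  be - bbar + b = 0 -> al - abar = 1 - a ->
  is_ext a b al be abar bbar 0 c%:PP.
Proof.
move=> hb h; rewrite -[c%:PP]mulr1; apply: is_ext_scale => l m x.
rewrite /ev2 !hornerE /=; apply/subr0_eq.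
have beE : be = bbar - b by apply: (eq_of_sub _ 1 _ _ _ _ hb); ring.
have alE : al = abar + 1 - a by apply: (eq_of_sub _ 1 _ _ _ _ h); ring.
by rewrite beE alE; ring.
Qed.

Theorem theorem3p9 (R : numClosedFieldType) (a b al abar be bbar : R) :
  (a, b) <> (1, 0) -> al != 0 -> abar != 0 -> be != bbar ->
  (* (0) *)
  (be - bbar + b != 0 ->
     forall f g : {poly {poly R}}, is_ext a b al be abar bbar f g ->
       ext_trivial al be abar bbar f g)
  /\
  (be - bbar + b = 0 ->
    (* reduction to f = 0 *)
    (forall f g : {poly {poly R}}, is_ext a b al be abar bbar f g ->
       exists g' : {poly {poly R}},
         is_ext a b al be abar bbar 0 g' /\ ext_equiv al be abar bbar f g 0 g')
    /\
    (* with f = 0: nontrivial iff g <> 0 *)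
    (forall g : {poly {poly R}}, is_ext a b al be abar bbar 0 g ->
       (~ ext_trivial al be abar bbar 0 g <-> g != 0))
    /\
    (* (2) a <> 1 *)
    (a != 1 -> forall g : {poly {poly R}}, g != 0 ->
       (is_ext a b al be abar bbar 0 g <->
        exists2 c : R, c != 0 &
          [\/ al - abar = 1 - a /\ g = c%:PP,
              al - abar = 2 - a /\ g = c%:PP * g2b a b abar bbar,
              [/\ al = 1, abar = a - 2 & g = c%:PP * g2c a b abar bbar]
            | [/\ al = 5%:R / 3%:R, a = 5%:R / 3%:R, abar = - (2%:R / 3%:R)
                & g = c%:PP * g2d b bbar]]))
    /\
    (* (3) a = 1 *)
    (a = 1 -> forall g : {poly {poly R}}, g != 0 ->
       (is_ext a b al be abar bbar 0 g <->
        exists2 c : R, c != 0 &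
          [\/ al = abar /\ g = c%:PP,
              al - abar = 1 /\ g = c%:PP * g3b b,
              al - abar = 2 /\ g = c%:PP * g3c b abar bbar
            | [/\ al = 1, abar = - 2%:R & g = c%:PP * g3d b bbar]]))).
Proof.
move=> _ al0 abar0 be_neq; split=> [nz f g ext|hb].
  have g0 := ext_W_eq0 _ _ _ _ _ _ _ _ _ nz ext.
  by rewrite /ext_trivial -{2}g0; apply: ext_equiv_split ext.
have beE : be = bbar - b by apply: (eq_of_sub _ 1 _ _ _ _ hb); ring.
split=> [f g ext|]; last split=> [g ext|].
(* The coboundary removing [f] leaves [g] as it is, so [g] itself is the witness. *)
- exists g; split; last exact: ext_equiv_split ext.
  rewrite -[g]mul1r; apply: is_ext_scale.
  by have /is_extP[_] := ext.
- split=> [|g0 /ext_equiv_W/eqP]; last by rewrite (negPf g0).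
  by apply: contra_notN => /eqP g0; move: ext; rewrite g0; exact: ext_equiv_split.
split=> [a1|a1] g g0.
  split; first exact: classify_a_neq1.
  have k0 : 1 - a != 0 by rewrite subr_eq0 eq_sym.
  case=> c _ [[alE ->]|[alE ->]|[alE abarE ->]|[alE aE abarE ->]].
  + exact: ext_const.
  + apply: is_ext_scale => l m x; rewrite !ev2_g2b beE (_ : al = abar + 2 - a).
      by field.
    by rewrite -addrA -alE; ring.
  + apply: is_ext_scale => l m x; rewrite !ev2_g2c beE alE abarE; by field.
  + apply: is_ext_scale => l m x; rewrite !ev2_g2d beE alE aE abarE; by field.
split; first exact: classify_a_eq1.
case=> c _ [[alE ->]|[alE ->]|[alE ->]|[alE abarE ->]].
- by apply: ext_const => //; rewrite alE a1 !subrr.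
- apply: is_ext_scale => l m x; rewrite !ev2_g3b beE a1 (_ : al = abar + 1).
    by ring.
  by rewrite -alE; ring.
- apply: is_ext_scale => l m x; rewrite !ev2_g3c beE a1 (_ : al = abar + 2).
    by ring.
  by rewrite -alE; ring.
- apply: is_ext_scale => l m x; rewrite !ev2_g3d beE a1 alE abarE; by ring.
Qed.
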